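(* Let $n\geq 2$ be an integer, let $a>1$ be a real number, let $\theta$ be a real number that is an irrational multiple of $\pi$, and put $a_1=ae^{i\theta}$ and $a_2=-1$. For $j=1,2$ let $A_j$ be the $n\times n$ complex matrix all of whose diagonal entries equal $a_j$, whose entry in row $1$ and column $n$ equals $1$, and all of whose other entries equal $0$. Then $(A_1,A_2)$ is a locally hypercyclic pair on $\mathbb{C}^n$ which is not hypercyclic. In particular, \[\{z\in\mathbb{C}^n : J_{(A_1,A_2)}(z)=\mathbb{C}^n\}=\{(z_1,0,\ldots,0)^t\in\mathbb{C}^n : z_1\in\mathbb{C}\}.\]
   Context: Here $\mathbb{N}=\{1,2,3,\ldots\}$ and $u^t$ denotes the transpose of $u$. Let $(T_1,T_2)$ be a pair of commuting complex $n\times n$ matrices, regarded as linear operators on $X=\mathbb{C}^n$. The pair is hypercyclic if there exists $x\in X$ such that $\{T_1^{k_1}T_2^{k_2}x : k_1,k_2\in\mathbb{N}\cup\{0\}\}$ is dense in $X$. For $x\in X$, the extended limit set $J_{(T_1,T_2)}(x)$ is the set of all $y\in X$ for which there exist a sequence of vectors $x_m\to x$ in $X$ and sequences of non-negative integers $\{k_m^{(1)}\}_{m\in\mathbb{N}}$, $\{k_m^{(2)}\}_{m\in\mathbb{N}}$ with $k_m^{(1)}+k_m^{(2)}\to+\infty$ such that $T_1^{k_m^{(1)}}T_2^{k_m^{(2)}}x_m\to y$. The pair is locally hypercyclic if there exists $x\in X\setminus\{0\}$ with $J_{(T_1,T_2)}(x)=X$. *)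

(* Defs.v *)
From HB Require Import structures.
From mathcomp Require Import all_boot all_order all_algebra.
From mathcomp Require Import all_classical all_reals all_analysis.
From mathcomp Require Import complex.

Set Implicit Arguments.
Unset Strict Implicit.
Unset Printing Implicit Defensive.

Import Order.TTheory GRing.Theory Num.Theory numFieldNormedType.Exports.

Local Open Scope classical_set_scope.
Local Open Scope ring_scope.
Local Open Scope complex_scope.

(* The topology on R[i] is the one of its modulus; it then induces the product
   topology on 'cV[R[i]]_n for every n. *)
HB.instance Definition _ (R : realType) := NormedModule.copy R[i] R[i]^o.

Definition expi (R : realType) (t : R) : R[i] := cos t +i* sin t.

Section pairs_of_matrices.
Context {R : realType} {n : nat}.
Implicit Types (T : 'M[R[i]]_n) (x : 'cV[R[i]]_n).

Definition orbit_pair T1 T2 x : set 'cV[R[i]]_n :=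
  [set y | exists k1 k2 : nat, y = T1 ^+ k1 *m T2 ^+ k2 *m x].

(* Commutation of T1 and T2 is not part of the definitions below, so that
   [~ hypercyclic T1 T2] really says that no orbit is dense. *)
Definition hypercyclic T1 T2 : Prop := exists x, dense (orbit_pair T1 T2 x).

Definition extended_limit_set T1 T2 x : set 'cV[R[i]]_n :=
  [set y | exists (u : nat -> 'cV[R[i]]_n) (k1 k2 : nat -> nat),
    [/\ u m @[m --> \oo] --> x,
        (k1 m + k2 m)%N @[m --> \oo] --> \oo &
        T1 ^+ k1 m *m T2 ^+ k2 m *m u m @[m --> \oo] --> y]].

Definition locally_hypercyclic T1 T2 : Prop :=
  exists2 x, x != 0 & extended_limit_set T1 T2 x = setT.

End pairs_of_matrices.

(* Rows and columns are numbered from 0: the entry 1 is in row 0, column n-1. *)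
Definition diag_corner_mx (R : realType) (n : nat) (c : R[i]) : 'M[R[i]]_n :=
  \matrix_(i, j) if i == j then c
                 else if (i == 0%N :> nat) && (j == n.-1 :> nat) then 1 else 0.

(* Main.v *)
Require Import Defs.
From HB Require Import structures.
From mathcomp Require Import all_boot all_order all_algebra.
From mathcomp Require Import all_classical all_reals all_analysis.
From mathcomp Require Import complex.
From mathcomp Require Import ring lra.
Import Order.TTheory GRing.Theory Num.Theory numFieldNormedType.Exports.
Local Open Scope classical_set_scope.
Local Open Scope ring_scope.
Local Open Scope complex_scope.

Set Implicit Arguments.
Unset Strict Implicit.
Unset Printing Implicit Defensive.

(** Write E for the matrix unit of the upper right corner.  Both matrices have
the form c I + E with E^2 = 0, so the powers are explicit: A_1^k A_2^l
multiplies each coordinate of index i > 0 by a_1^k (-1)^l, while coordinate 0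
also receives a_1^k (-1)^l (k / a_1 - l) times the last coordinate.

As |a_1| = a > 1 and |a_2| = 1, the modulus of a coordinate of index i > 0
never decreases along an orbit ([normc_orbit_coord]).  Hence vectors close to z
cannot be sent close to 0 when some z_i with i > 0 is nonzero
([coord_eq0_of_full_limit_set]), and no orbit is dense
([not_hypercyclic_diag_corner]).

Conversely let z = (z_0, 0, ..., 0) and let y be arbitrary, with last entry
s <> 0 after a small perturbation.  For even l = 2p, the equation
A_1^k A_2^l v = y has a unique solution v, whose coordinates of index i > 0
are y_i a_1^(-k) and whose coordinate 0 is 2p a_1^(-k) s plus terms of size
O(k a^(-k)).  So v is close to z as soon as k is large and 2p a_1^(-k) is close
to z_0 / s.  Such k and p exist ([spiral_dense]): theta being an irrational
multiple of pi, the argument of a_1^(-k) can be brought close to any given one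
for arbitrarily large k ([expi_dense], from the density of the multiples of an
irrational number modulo 1, [dense_mod1]); then the mesh 2 a^(-k) of the even
multiples of a_1^(-k) on that ray is fine enough to adjust the modulus with p.
This is how the contraction by a_1^(-k) gets compensated by the shear of A_2,
which grows without bound while its eigenvalue stays on the unit circle. *)

(** * Multiples of an irrational number modulo 1 *)

(** Dirichlet's approximation theorem, by the pigeonhole principle: among the
M + 1 fractional parts of k x with k <= M, two lie in the same of the M boxes
of length 1 / M, and q is the difference of the two indices. *)
Lemma dirichlet_approx (R : realType) (x : R) (M : nat) : (0 < M)%N ->
  exists2 q : nat, (0 < q)%N & exists p : int, `|q%:R * x - p%:~R| < M%:R^-1.
Proof.
move=> M0; have M0R : 0 < M%:R :> R by rewrite ltr0n.
pose fr (k : nat) : R := k%:R * x - (Num.floor (k%:R * x))%:~R.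
have fr01 k : 0 <= fr k < 1.
  by have := floor_itv (k%:R * x); rewrite /fr intrD; lra.
have frM k : 0 <= M%:R * fr k by rewrite mulr_ge0 ?ler0n//; case/andP: (fr01 k).
have lt_box (k : 'I_M.+1) : (Num.truncn (M%:R * fr k) < M)%N.
  rewrite -(ltr_nat R); have /andP[+ _] := truncn_itv (frM k).
  by move/le_lt_trans; apply; rewrite gtr_pMr//; case/andP: (fr01 k).
pose box (k : 'I_M.+1) : 'I_M := Ordinal (lt_box k).
have /injectivePn[i [j neq_ij eq_box]] : ~~ injectiveb box.
  by apply/injectiveP => /leq_card; rewrite !card_ord ltnn.
wlog lt_ij : i j neq_ij eq_box / (i < j)%N.
  move=> H; case: (ltngtP i j) => [lt|lt|e]; first exact: (H i j).
    by apply: (H j i) => //; rewrite eq_sym.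
  by move: neq_ij; rewrite -val_eqE/= e eqxx.
exists (j - i)%N; first by rewrite subn_gt0.
exists (Num.floor (j%:R * x) - Num.floor (i%:R * x)).
have -> : (j - i)%:R * x - (Num.floor (j%:R * x) - Num.floor (i%:R * x))%:~R
    = fr j - fr i.
  by rewrite natrB 1?ltnW// intrB /fr; ring.
rewrite -(ltr_pM2l M0R) divff ?gt_eqF// -[X in X * `|_|]gtr0_norm// -normrM.
have := truncn_itv (frM i); have := truncn_itv (frM j).
have -> : Num.truncn (M%:R * fr i) = Num.truncn (M%:R * fr j).
  by have := congr1 val eq_box.
by rewrite -!natr1 ltr_norml; lra.
Qed.

(** If q x is congruent modulo 1 to some d in ]0, e[, the multiples of q x walk
along the line, modulo 1, with steps shorter than e.  Shifting the target t by
a large integer l makes the number of steps needed to reach it at least N. *)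
Lemma dense_mod1_step (R : realType) (x t e : R) (N q : nat) (p : int) :
  (0 < q)%N -> 0 < q%:R * x - p%:~R < e ->
  exists2 k : nat, (N <= k)%N & exists m : int, `|k%:R * x - t - m%:~R| < e.
Proof.
move=> q0; set d := _ - _ => /andP[d0 de].
pose l := Num.bound (`|t| + N%:R * d).
have ltl : `|t| + N%:R * d < l%:R.
  by apply: archi_boundP; rewrite addr_ge0// mulr_ge0// ltW.
have Nd : N%:R * d <= t + l%:R.
  by have := ler_norm (- t); rewrite normrN; lra.
have Nq : N%:R <= (t + l%:R) / d by rewrite ler_pdivlMr.
pose j := Num.truncn ((t + l%:R) / d).
have /andP[] := truncn_itv (le_trans (ler0n _ _) Nq).
rewrite -/j -natr1 ler_pdivlMr// ltr_pdivrMr// => jle ltj.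
exists (j * q)%N.
  apply: leq_trans (leq_pmulr _ q0).
  rewrite -ltnS -(ltr_nat R) -natr1.
  by rewrite -(ltr_pM2r d0); lra.
exists (p * j%:Z + l%:Z).
have -> : (j * q)%:R * x - t - (p * j%:Z + l%:Z)%:~R = j%:R * d - t - l%:R.
  by rewrite natrM intrD intrM -!pmulrn /d; ring.
rewrite ltr_norml; lra.
Qed.

(** Dirichlet's theorem provides a step d = q x - p with |d| < e, nonzero
because x is irrational.  A negative step for x is a positive one for - x. *)
Lemma dense_mod1 (R : realType) (x : R) (t e : R) (N : nat) : irrational x ->
  0 < e ->
  exists2 k : nat, (N <= k)%N & exists m : int, `|k%:R * x - t - m%:~R| < e.
Proof.
move=> irr_x e0.
pose M := Num.bound e^-1.
have leM : e^-1 < M%:R by apply: archi_boundP; rewrite invr_ge0 ltW.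
have M0 : (0 < M)%N.
  by rewrite -(ltr_nat R); apply: lt_trans leM; rewrite invr_gt0.
have [q q0 [p qp]] := @dirichlet_approx R x M M0.
have q0R : q%:R != 0 :> R by rewrite pnatr_eq0 -lt0n.
have d0 : q%:R * x - p%:~R != 0.
  apply/eqP => d0; apply: irr_x; exists (p%:~R / q%:R) => //.
  rewrite fmorph_div/= ratr_int ratr_nat; apply: (mulfI q0R).
  by rewrite mulrC divfK//; lra.
have {qp} : `|q%:R * x - p%:~R| < e.
  by apply: lt_trans qp _; rewrite invf_plt ?posrE// ?ltr0n.
rewrite ltr_norml => de.
have [d_gt0|d_lt0|d_eq0] := ltgtP 0 (q%:R * x - p%:~R).
- by apply: (@dense_mod1_step _ _ _ _ _ q p) => //; lra.
- have [|k Nk [m km]] := @dense_mod1_step _ (- x) (- t) e N q (- p) q0.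
    by rewrite mulrN mulrNz; lra.
  exists k => //; exists (- m).
  by rewrite -normrN; move: km; congr (`| _ | < _); rewrite mulrNz; ring.
- by rewrite -d_eq0 eqxx in d0.
Qed.

Import ComplexField.Normc.

(** * The circle and the spiral *)

Section exponential_on_circle.
Context {R : realType}.
Implicit Types (s t : R) (z w : R[i]).

Lemma normrcE z : `|z| = (normc z)%:C. Proof. by []. Qed.

Lemma normc_real (x : R) : normc x%:C = `|x|.
Proof. by rewrite /= expr0n addr0 sqrtr_sqr. Qed.

Lemma normc_ge0 z : 0 <= normc z.
Proof. by case: z => x y; apply: sqrtr_ge0. Qed.

Lemma normc_gt0 z : z != 0 -> 0 < normc z.
Proof.
move=> z0; rewrite lt_def normc_ge0 andbT.
by apply: contra z0 => /eqP/eq0_normc->.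
Qed.

Lemma normcX z k : normc (z ^+ k) = normc z ^+ k.
Proof. by elim: k => [|k IH]; rewrite ?expr0 ?normc1// !exprS normcM IH. Qed.

Lemma expiD s t : expi (s + t) = expi s * expi t.
Proof.
rewrite /expi cosD sinD; apply/eqP; rewrite eq_complex/= eqxx/=.
by rewrite addrC [cos s * _]mulrC mulrC eqxx.
Qed.

Lemma expi0 : expi 0 = 1 :> R[i].
Proof. by rewrite /expi cos0 sin0. Qed.

Lemma expiMn t k : expi t ^+ k = expi (k%:R * t).
Proof.
elim: k => [|k IH]; first by rewrite expr0 mul0r expi0.
by rewrite exprS IH -expiD mulrSr; congr expi; ring.
Qed.

Lemma expiN t : expi (- t) = (expi t)^-1.
Proof. by apply/esym/mulr1_eq; rewrite -expiD subrr expi0. Qed.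

Lemma normc_expi t : normc (expi t) = 1.
Proof. by rewrite /= cos2Dsin2 sqrtr1. Qed.

Lemma expi_periodic t (m : int) : expi (t + m%:~R * (pi *+ 2)) = expi t.
Proof.
have P k s : expi (s + k%:R * (pi *+ 2)) = expi s.
  rewrite expiD -expiMn /expi cos2pi sin2pi.
  by rewrite [1 +i* 0](_ : _ = 1)// expr1n mulr1.
case: (intP m) => [|k|k]; first by rewrite mul0r addr0.
  exact: P.
by rewrite -[LHS](P k.+1) mulrNz mulNr subrK.
Qed.

(** The arccosine of the real part gives the argument in the upper half plane, and
its opposite in the lower one. *)
Lemma polar_form z : exists t, z = (normc z)%:C * expi t.
Proof.
have [->|z0] := eqVneq z 0; first by exists 0; rewrite normc0 mul0r.
have r0 := normc_gt0 z0.
suff [t zt] : exists t, z / (normc z)%:C = expi t.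
  by exists t; rewrite -zt mulrC divfK// eq_complex/= gt_eqF.
have : normc (z / (normc z)%:C) = 1.
  by rewrite normcM normcV normc_real ger0_norm ?ltW// divff// gt_eqF.
case: (_ / _) => x y /= xy1.
have {}xy1 : x ^+ 2 + y ^+ 2 = 1.
  by rewrite -[LHS]sqr_sqrtr ?xy1 ?expr1n// addr_ge0 ?sqr_ge0.
have x11 : -1 <= x <= 1 by nra.
have sE : Num.sqrt (1 - x ^+ 2) = `|y|.
  by rewrite -sqrtr_sqr; congr Num.sqrt; lra.
have [y0|y0] := leP 0 y.
  exists (acos x); rewrite /expi acosK ?in_itv//= sin_acos// sE.
  by rewrite ger0_norm.
exists (- acos x); rewrite /expi cosN sinN acosK ?in_itv//= sin_acos// sE.
by rewrite ltr0_norm// opprK.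
Qed.

Lemma normc_le_ReIm (x y : R) : normc (x +i* y) <= `|x| + `|y|.
Proof.
rewrite /= -[leRHS]ger0_norm ?addr_ge0// -sqrtr_sqr.
rewrite ler_sqrt ?sqr_ge0// sqrrD !real_normK ?num_real//.
by rewrite -addrA lerD2l lerDr mulrn_wge0// mulr_ge0.
Qed.

Lemma expi_continuous t (e : R) : 0 < e ->
  exists2 d : R, 0 < d & forall s, `|s - t| < d -> normc (expi s - expi t) < e.
Proof.
move=> e0; have e20 : 0 < e / 2 by rewrite divr_gt0.
have /cvgrPdist_lt/(_ _ e20)/nbhs_ballP[d1 /= d10 H1] := @continuous_cos R t.
have /cvgrPdist_lt/(_ _ e20)/nbhs_ballP[d2 /= d20 H2] := @continuous_sin R t.
exists (Num.min d1 d2); first by rewrite lt_min d10.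
move=> s; rewrite lt_min distrC => /andP[/H1/= s1 /H2/= s2].
apply: le_lt_trans (normc_le_ReIm _ _) _ => /=.
by rewrite [`|cos s - _|]distrC [`|sin s - _|]distrC; lra.
Qed.

(** Angles are measured in turns: k theta / (2 pi) = k (r / 2) has to come close
to phi / (2 pi) modulo 1. *)
Lemma expi_dense (theta phi e : R) (N : nat) :
  (exists2 r : R, irrational r & theta = r * pi) -> 0 < e ->
  exists2 k, (N <= k)%N & normc (expi (k%:R * theta) - expi phi) < e.
Proof.
move=> [r irr_r ->] e0.
have [d d0 Hd] := expi_continuous phi e0.
have pi2 : 0 < pi *+ 2 :> R by rewrite mulrn_wgt0// pi_gt0.
have irr_r2 : irrational (r / 2).
  move=> [q _ qr]; apply: irr_r; exists (q * 2) => //.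
  by rewrite rmorphM/= qr ratr_nat divfK.
have [k Nk [m km]] :=
  dense_mod1 (phi / (pi *+ 2)) N irr_r2 (divr_gt0 d0 pi2).
exists k => //; rewrite -(expi_periodic _ (- m)); apply: Hd.
rewrite -(ltr_pM2r (x := (pi *+ 2)^-1)) ?invr_gt0//.
rewrite -[X in `|_| * X]gtr0_norm ?invr_gt0// -normrM.
move: km; congr (`| _ | < _); rewrite mulrNz.
have : pi != 0 :> R by rewrite gt_eqF// pi_gt0.
by clear pi2; move: pi => p p0; field.
Qed.

End exponential_on_circle.

Section growth.
Context {R : realType}.

(** Bernoulli's inequality for b = sqrt a gives h (k + 1) <= b^k for some h > 0;
squaring yields a lower bound of a^k that is quadratic in k. *)
Lemma geometric_beats_linear (a C : R) : 1 < a ->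
  exists N : nat, forall k, (N <= k)%N -> C * k.+1%:R < a ^+ k.
Proof.
move=> a1; pose b := Num.sqrt a.
have b2 : b ^+ 2 = a by rewrite sqr_sqrtr// ltW// (lt_trans _ a1).
have b1 : 1 < b by rewrite -sqrtr1 ltr_sqrt// (lt_trans _ a1).
pose h := Num.min 1 (b - 1).
have h0 : 0 < h by rewrite lt_min ltr01 subr_gt0.
have [h1 hb] : h <= 1 /\ h <= b - 1 by split; rewrite ge_min lexx ?orbT.
have bk k : h * k.+1%:R <= b ^+ k.
  elim: k => [|k IH]; first by rewrite mulr1 expr0.
  have bk1 : 1 <= b ^+ k by rewrite exprn_ege1// ltW.
  by rewrite exprS -natr1; nra.
exists (Num.bound (`|C| / h ^+ 2)) => k Nk.
have C_lt : `|C| < h ^+ 2 * k.+1%:R.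
  rewrite mulrC -ltr_pdivrMr ?exprn_gt0//.
  apply: lt_le_trans (archi_boundP _) _.
    by rewrite divr_ge0// exprn_ge0// ltW.
  by rewrite ler_nat ltnW.
have k0 : 0 < k.+1%:R :> R by rewrite ltr0n.
apply: (@lt_le_trans _ _ ((h * k.+1%:R) ^+ 2)).
  rewrite exprMn [k.+1%:R ^+ 2]expr2 mulrA ltr_pM2r//.
  exact: le_lt_trans (ler_norm _) C_lt.
rewrite -b2 exprAC lerXn2r ?nnegrE ?bk ?mulr_ge0 ?exprn_ge0 ?ltW//.
exact: lt_trans b1.
Qed.

(** The points m a^(-k) e^(-i k theta), with m even, are dense in the plane,
however large k is required to be.  Let w = rho e^(i phi): first k is chosen so
that the ray of argument - k theta passes near e^(i phi), then 2p as the largest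
even number below rho a^k, which costs an error of at most 2 / a^k. *)
Lemma spiral_dense (a theta : R) (w : R[i]) (e : R) (N : nat) : 1 < a ->
  (exists2 r : R, irrational r & theta = r * pi) -> 0 < e ->
  exists k p : nat, (N <= k)%N /\
    normc ((p.*2)%:R * (a%:C * expi theta) ^- k - w) < e.
Proof.
move=> a1 [r irr_r thetaE] e0.
have [phi wE] := polar_form w; set rho := normc w in wE.
have rho0 : 0 <= rho by apply: normc_ge0.
have [K HK] := geometric_beats_linear (4 / e) a1.
have e'0 : 0 < e / 2 / (rho + 1) by rewrite !divr_gt0// ltr_wpDl.
have irr_Nr : exists2 r : R, irrational r & - theta = r * pi.
  exists (- r); last by rewrite thetaE mulNr.
  move=> [q _ qr]; apply: irr_r; exists (- q) => //.
  by rewrite rmorphN/= qr opprK.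
have [k Nk phik] := expi_dense phi (maxn N K) irr_Nr e'0.
have ak0 : 0 < a ^+ k by rewrite exprn_gt0// (lt_trans _ a1).
have {HK} ak : 4 / e < a ^+ k.
  have := HK _ (leq_trans (leq_maxr _ _) Nk); apply: le_lt_trans.
  by rewrite ler_peMr ?ler1n// divr_ge0// ltW.
pose p := Num.truncn (rho * a ^+ k / 2).
have /truncn_itv : 0 <= rho * a ^+ k / 2 by rewrite !mulr_ge0// ltW.
rewrite -/p -(natr1 p) => /andP[p1 p2].
exists k, p; split; first exact: leq_trans (leq_maxl _ _) Nk.
(* a radial error, then an angular one *)
have -> : p.*2%:R * (a%:C * expi theta) ^- k - w =
    (p.*2%:R / a ^+ k - rho)%:C * expi (k%:R * - theta)
    + rho%:C * (expi (k%:R * - theta) - expi phi).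
  rewrite {1}wE exprMn invfM -[X in a%:C ^- k * X]exprVn -expiN expiMn.
  rewrite rmorphB rmorphM/= fmorphV rmorphXn rmorph_nat/=; ring.
apply: le_lt_trans (le_normcD _ _) _.
rewrite !normcM !normc_real normc_expi mulr1 (ger0_norm rho0).
have A1 : `|p.*2%:R / a ^+ k - rho| < e / 2.
  have -> : p.*2%:R / a ^+ k - rho = (p.*2%:R - rho * a ^+ k) / a ^+ k.
    by field; rewrite gt_eqF.
  rewrite normrM normfV (gtr0_norm ak0) ltr_pdivrMr//.
  have ak2 : 2 < e / 2 * a ^+ k.
    by move: ak; rewrite ltr_pdivrMr// [_ * e]mulrC; lra.
  by rewrite -mul2n natrM ltr_norml; lra.
have A2 : rho * normc (expi (k%:R * - theta) - expi phi) <= e / 2.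
  move: phik; rewrite ltr_pdivlMr ?ltr_wpDl// => phik; apply: ltW.
  by apply: le_lt_trans phik; rewrite mulrC ler_wpM2l ?normc_ge0//; lra.
lra.
Qed.

End growth.

(** * Extended limit sets, coordinate by coordinate *)

Section coordinatewise_convergence.
Context {R : realType} {n : nat}.
Implicit Types (x y : 'cV[R[i]]_n) (u : nat -> 'cV[R[i]]_n).

Lemma cV_ballE x y (e : R) :
  ball x e%:C y <-> 0 < e /\ forall i, normc (x i 0 - y i 0) < e.
Proof.
split=> [[e0 xy]|[e0 xy]]; split; rewrite ?ltcR// in e0 *.
  by move=> i; have := xy i 0; rewrite /ball/= normrcE ltcR.
by move=> i j; rewrite (ord1 j) /ball/= normrcE ltcR.
Qed.

Lemma cV_cvgP u x : u m @[m --> \oo] --> x <->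
  forall e : R, 0 < e ->
    \forall m \near \oo, forall i, normc (x i 0 - u m i 0) < e.
Proof.
split=> [/cvg_ballP ux e e0|ux].
  have /ux : 0 < e%:C by rewrite ltcR.
  by apply: filterS => m /cV_ballE[].
apply/cvg_ballP => e e0.
(* radii of balls are complex numbers; a positive one is real *)
have /complex_realP[r rE] := gtr0_real e0.
rewrite rE ltcR in e0 *; apply: filterS (ux _ e0) => m um.
exact/cV_ballE.
Qed.

(** A pointwise form of membership in the extended limit set, in which the
sequences have disappeared; they are recovered by choosing, for each m, a
witness for e = 1 / (m + 1) and N = m. *)
Lemma extended_limit_setP T1 T2 x y : extended_limit_set T1 T2 x y <->
  forall (e : R) (N : nat), 0 < e ->
    exists (v : 'cV[R[i]]_n) (k l : nat), [/\ (N <= k + l)%N,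
    forall i, normc (x i 0 - v i 0) < e &
    forall i, normc (y i 0 - (T1 ^+ k *m T2 ^+ l *m v) i 0) < e].
Proof.
split=> [[u [k [l [/cV_cvgP ux klN /cV_cvgP Tuy]]]] e N e0|H].
  have [m [[xu Ty] Nkl]] := filter_ex
    (filterI (filterI (ux _ e0) (Tuy _ e0)) (klN _ (nbhs_infty_ge N))).
  by exists (u m), (k m), (l m).
have /choice[f Hf] : forall m : nat, exists vkl : 'cV[R[i]]_n * nat * nat,
    let: (v, k, l) := vkl in
    [/\ (m <= k + l)%N, forall i, normc (x i 0 - v i 0) < m.+1%:R^-1 &
    forall i, normc (y i 0 - (T1 ^+ k *m T2 ^+ l *m v) i 0) < m.+1%:R^-1].
  move=> m; have [|v [k [l vkl]]] := H m.+1%:R^-1 m; first by rewrite invr_gt0.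
  by exists (v, k, l).
exists (fun m => (f m).1.1), (fun m => (f m).1.2), (fun m => (f m).2); split.
- apply/cV_cvgP => e e0; near=> m => i.
  have := Hf m; case: (f m) => -[v k] l /= [_ /(_ i) + _]; move/lt_trans; apply.
  by near: m; exact: (near_infty_natSinv_lt (PosNum e0)).
- apply/cvgnyPge => N; near=> m.
  have := Hf m; case: (f m) => -[v k] l /= [+ _ _]; apply: leq_trans.
  by near: m; exact: nbhs_infty_ge.
- apply/cV_cvgP => e e0; near=> m => i.
  have := Hf m; case: (f m) => -[v k] l /= [_ _ /(_ i)]; move/lt_trans; apply.
  by near: m; exact: (near_infty_natSinv_lt (PosNum e0)).
Unshelve. all: by end_near.
Qed.

End coordinatewise_convergence.

(** * Powers of the matrices *)

Section diag_corner.
Context {R : realType} {n : nat}.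
Local Notation A c := (diag_corner_mx n.+2 c : 'M[R[i]]_n.+2).
Implicit Types (c : R[i]) (v : 'cV[R[i]]_n.+2).

Lemma diag_corner_mxE c : A c = c%:M + delta_mx ord0 ord_max.
Proof.
apply/matrixP => i j; rewrite !mxE.
have [->|ij] := eqVneq i j; last first.
  by rewrite mulr0n add0r -!val_eqE/=; case: ifP.
rewrite mulr1n -!val_eqE/=; case: eqP => [->|_]; rewrite ?addr0//=.
Qed.

Lemma comm_diag_corner_mx c d : comm_mx (A c) (A d).
Proof.
rewrite !diag_corner_mxE; apply: comm_mxD; first exact: comm_mx_scalar.
by apply: comm_mx_sym; apply: comm_mxD => //; exact: comm_mx_scalar.
Qed.

Lemma diag_corner_mulmx c v i :
  (A c *m v) i 0 = c * v i 0 + (if i == ord0 then v ord_max 0 else 0).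
Proof.
rewrite diag_corner_mxE mulmxDl mul_scalar_mx !mxE; congr (_ + _).
rewrite (bigD1 ord_max)//= !mxE eqxx andbT big1 ?addr0.
  by case: eqP => _; rewrite ?mul1r ?mul0r.
by move=> j jmax; rewrite mxE (negbTE jmax) andbF mul0r.
Qed.

(** Since the corner unit squares to 0, this is the two-term binomial formula
(c I + E)^k = c^k I + k c^(k-1) E. *)
Lemma diag_corner_exp_mulmx c k v i : (A c ^+ k *m v) i 0 =
  c ^+ k * v i 0 + (if i == ord0 then k%:R * c ^+ k.-1 * v ord_max 0 else 0).
Proof.
elim: k i => [|k IH] i.
  by rewrite !expr0 mul1mx mul1r !mul0r; case: ifP; rewrite addr0.
rewrite exprS -mulmxE -mulmxA diag_corner_mulmx !IH/=.
case: ifP => // _; last by rewrite !addr0 exprS mulrA.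
case: k {IH} => [|k]; first by rewrite !expr0; ring.
by rewrite !exprS/= -[k.+2%:R]natr1; ring.
Qed.

Lemma orbit_coord c d k l v i : i != ord0 ->
  (A c ^+ k *m A d ^+ l *m v) i 0 = c ^+ k * d ^+ l * v i 0.
Proof.
by move=> i0; rewrite -mulmxA !diag_corner_exp_mulmx (negbTE i0) !addr0 mulrA.
Qed.

Lemma orbit_coord0 c d k l v :
  (A c ^+ k *m A d ^+ l *m v) ord0 0 =
  c ^+ k * (d ^+ l * v ord0 0 + l%:R * d ^+ l.-1 * v ord_max 0)
  + k%:R * c ^+ k.-1 * (d ^+ l * v ord_max 0).
Proof. by rewrite -mulmxA !diag_corner_exp_mulmx/= addr0. Qed.

End diag_corner.

(** * Orbits and extended limit sets of the pair *)

Section dynamics.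
Context {R : realType} {n : nat}.
Local Notation A c := (diag_corner_mx n.+2 c : 'M[R[i]]_n.+2).
Implicit Types (c d : R[i]) (v x y z : 'cV[R[i]]_n.+2).

Lemma normc_orbit_coord c d k l v i : 1 <= normc c -> 1 <= normc d ->
  i != ord0 -> normc (v i 0) <= normc ((A c ^+ k *m A d ^+ l *m v) i 0).
Proof.
move=> c1 d1 i0; rewrite orbit_coord// !normcM !normcX.
by rewrite ler_peMl ?normc_ge0// mulr_ege1// exprn_ege1.
Qed.

(** If the coordinate z_i were nonzero, the images of the vectors close to z
would have a coordinate of modulus at least |z_i| / 2, and 0 would not be a
limit. *)
Lemma coord_eq0_of_full_limit_set c d z i : 1 <= normc c -> 1 <= normc d ->
  i != ord0 -> extended_limit_set (A c) (A d) z = setT -> z i 0 = 0.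
Proof.
move=> c1 d1 i0 Jz; apply/eqP/negPn/negP => zi0.
have e0 : 0 < normc (z i 0) / 2 by rewrite divr_gt0// normc_gt0.
have : extended_limit_set (A c) (A d) z 0 by rewrite Jz.
move=> /extended_limit_setP/(_ _ 0 e0)[v [k [l [_ /(_ i) zv /(_ i)]]]].
rewrite mxE sub0r normcN => Av.
have := normc_orbit_coord k l v c1 d1 i0.
have := le_normcD (z i 0 - v i 0) (v i 0); rewrite subrK.
lra.
Qed.

(** The last coordinate of an orbit either vanishes identically, and then misses
a neighborhood of 1, or has modulus bounded below, and then misses a
neighborhood of 0. *)
Lemma not_hypercyclic_diag_corner c d : 1 <= normc c -> 1 <= normc d ->
  ~ hypercyclic (A c) (A d).
Proof.
move=> c1 d1 [v dense_v]; have i0 : ord_max != ord0 :> 'I_n.+2 by [].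
have meets (y : 'cV[R[i]]_n.+2) (e : R) : 0 < e ->
    exists k l, normc (y ord_max 0 - (A c ^+ k *m A d ^+ l *m v) ord_max 0) < e.
  move=> e0; have eC0 : 0 < e%:C by rewrite ltcR.
  have [||w [yw [k [l wE]]]] := dense_v (interior (ball y e%:C)).
  - by exists y; apply: nbhsx_ballx.
  - exact: open_interior.
  - exists k, l; rewrite -wE.
    by have /cV_ballE[_] := interior_subset yw.
have [v0|v0] := eqVneq (v ord_max 0) 0.
  have [k [l]] := meets (const_mx 1) 1 ltr01.
  by rewrite orbit_coord// v0 mulr0 mxE subr0 normc1 ltxx.
have [k [l]] := meets 0 _ (normc_gt0 v0).
rewrite mxE sub0r normcN ltNge.
by rewrite (normc_orbit_coord k l v c1 d1 i0).
Qed.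

(** Given y, the vector v that A_1^k A_2^(2p) sends exactly to (a perturbation
of) y is written down, and k and p are chosen to bring it close to z. *)
Lemma extended_limit_set_axis (a theta : R) (z1 : R[i]) : 1 < a ->
  (exists2 r : R, irrational r & theta = r * pi) ->
  extended_limit_set (A (a%:C * expi theta)) (A (- 1))
    (\col_i (if i == 0%N :> nat then z1 else 0)) = setT.
Proof.
move=> a1 irr; apply/seteqP; split => // y _.
apply/extended_limit_setP => e N e0.
set c := _ * _; have a0 : 0 < a by rewrite (lt_trans _ a1).
have normc_c : normc c = a.
  by rewrite normcM normc_expi mulr1 normc_real gtr0_norm.
have c0 : c != 0.
  by apply: contraTneq a0 => c0; rewrite -normc_c c0 normc0 ltxx.
(* The shear acts through the last entry s of the target, and z1 / s is going
to be approximated: y' is y, with its last entry made nonzero if it was 0. *)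
pose y' : 'cV[R[i]]_n.+2 := \col_i
  if (i == ord_max) && (y i 0 == 0) then (e / 2)%:C else y i 0.
have y'y i : normc (y i 0 - y' i 0) < e.
  rewrite mxE; case: ifPn => [/andP[_ /eqP->]|_]; last by rewrite subrr normc0.
  by rewrite sub0r normcN normc_real gtr0_norm; lra.
set s := y' ord_max 0.
have s0 : s != 0.
  rewrite /s mxE eqxx/=; case: ifPn => // _.
  by rewrite gt_eqF// ltcR divr_gt0.
have s_gt0 := normc_gt0 s0.
pose B := \sum_i normc (y' i 0).
have leB i : normc (y' i 0) <= B.
  by rewrite /B (bigD1 i)//= lerDl sumr_ge0// => *; apply: normc_ge0.
have [K HK] := geometric_beats_linear (2 * B / e) a1.
have e'0 : 0 < e / 2 / normc s by rewrite !divr_gt0.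
have [k [p [Nk kp]]] := spiral_dense (z1 / s) (maxn N K) a1 irr e'0.
rewrite -/c in kp.
have {}HK := HK _ (leq_trans (leq_maxr _ _) Nk).
have ak0 : 0 < a ^+ k by rewrite exprn_gt0.
have ck0 : c ^+ k != 0 by rewrite expf_neq0.
(* this disposes of all the terms of v but the shear 2p a_1^(-k) s *)
have small (u : R[i]) : normc u <= B * k.+1%:R -> normc (u / c ^+ k) < e / 2.
  move=> uB; rewrite normcM normcV normcX normc_c ltr_pdivrMr//.
  by move: HK; rewrite mulrAC ltr_pdivrMr//; lra.
pose v : 'cV[R[i]]_n.+2 := \col_i (y' i 0 / c ^+ k +
   if i == ord0 then (p.*2%:R - k%:R / c) * (s / c ^+ k) else 0).
have vi i : i != ord0 -> v i 0 = y' i 0 / c ^+ k.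
  by move=> i0; rewrite mxE (negbTE i0) addr0.
have p2even l : (-1) ^+ l.*2 = 1 :> R[i] by rewrite -signr_odd odd_double.
exists v, k, p.*2; split=> [|i|i].
- exact/(leq_trans _ (leq_addr _ _))/(leq_trans _ Nk)/leq_maxl.
- rewrite mxE; case: eqP => i0.
    have -> : i = ord0 by apply: val_inj.
    rewrite mxE/=.
    have -> : z1 - (y' ord0 0 / c ^+ k + (p.*2%:R - k%:R / c) * (s / c ^+ k)) =
       - ((y' ord0 0 - k%:R * (s / c)) / c ^+ k)
       + - (s * (p.*2%:R * c ^- k - z1 / s)).
      by field; rewrite s0 ck0 c0.
    apply: le_lt_trans (le_normcD _ _) _; rewrite !normcN.
    have A1 : normc ((y' ord0 0 - k%:R * (s / c)) / c ^+ k) < e / 2.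
      apply: small; apply: le_trans (le_normcD _ _) _.
      rewrite normcN -natr1 mulrDr mulr1 addrC lerD ?leB//.
      rewrite !normcM normcV normc_c -(rmorph_nat (real_complex R)) normc_real.
      rewrite normr_nat mulrC ler_wpM2r// ler_pdivrMr//.
      rewrite (le_trans (leB _))// ler_peMr ?ltW//.
      exact: lt_le_trans s_gt0 (leB _).
    have A2 : normc (s * (p.*2%:R * c ^- k - z1 / s)) < e / 2.
      by rewrite normcM mulrC -ltr_pdivlMr.
    lra.
  rewrite vi; last by rewrite -val_eqE; apply/eqP.
  rewrite sub0r normcN; apply: lt_trans (small _ _) _; last lra.
  apply: le_trans (leB i) _; rewrite ler_peMr ?ler1n//.
  exact: le_trans (ltW s_gt0) (leB _).
- suff -> : (A c ^+ k *m A (-1) ^+ p.*2 *m v) i 0 = y' i 0 by [].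
  have [->|i0] := eqVneq i ord0; last first.
    by rewrite orbit_coord// vi// p2even mulr1 mulrC divfK.
  rewrite orbit_coord0 p2even !mul1r (vi ord_max)// -/s mxE/=.
  have -> : p.*2%:R * (-1) ^+ p.*2.-1 = - p.*2%:R :> R[i].
    case: p {kp v vi} => [|p]; first by rewrite mul0r oppr0.
    by rewrite doubleS/= exprS p2even mulr1 mulrN1.
  have -> : k%:R * c ^+ k.-1 = k%:R * c ^+ k / c.
    case: (k) => [|k']; first by rewrite !mul0r.
    by rewrite exprS/=; field.
  by field; rewrite ck0 c0.
Qed.

End dynamics.

Theorem theorem5p6 (R : realType) (n : nat) (hn : (2 <= n)%N)
    (a : R) (ha : 1 < a)
    (theta : R) (htheta : exists2 r : R, irrational r & theta = r * pi) :
  let a1 : R[i] := a%:C * expi theta in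
  let a2 : R[i] := -1 in
  let A1 : 'M[R[i]]_n := diag_corner_mx n a1 in
  let A2 : 'M[R[i]]_n := diag_corner_mx n a2 in
  [/\ comm_mx A1 A2,
      locally_hypercyclic A1 A2,
      ~ hypercyclic A1 A2 &
      [set z : 'cV[R[i]]_n | extended_limit_set A1 A2 z = setT] =
      [set z : 'cV[R[i]]_n |
        exists z1 : R[i], z = \col_i (if i == 0%N :> nat then z1 else 0)]].
Proof.
case: n hn => [|[|n]]// _ a1 a2 A1 A2.
have a1_ge1 : 1 <= normc a1.
  rewrite normcM normc_expi mulr1 normc_real gtr0_norm ?ltW//.
  exact: lt_trans ha.
have a2_ge1 : 1 <= normc a2 by rewrite normcN normc1.
have full z1 := extended_limit_set_axis (n := n) z1 ha htheta.
split.
- exact: comm_diag_corner_mx.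
- exists (\col_i (if i == 0%N :> nat then 1 else 0)); last exact: full.
  apply/eqP => /matrixP/(_ ord0 0); rewrite !mxE/= => /eqP.
  by rewrite oner_eq0.
- exact: not_hypercyclic_diag_corner.
- apply/seteqP; split => [z Jz|z [z1 ->]]; last exact: full.
  exists (z ord0 0); apply/matrixP => i j; rewrite (ord1 j) mxE.
  case: eqP => i0; first by congr (z _ _); apply: val_inj.
  apply: coord_eq0_of_full_limit_set Jz => //.
  by rewrite -val_eqE; apply/eqP.
Qed.
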